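(* A graph $G$ is $12$-representable by a $231$-avoiding word if and only if $G$ is a trivially perfect graph.
   Context: All graphs are finite, simple and undirected. Let $[n]=\{1,\ldots,n\}$. For a word $w$ over positive integers, $\mathrm{red}(w)$ is the word obtained from $w$ by replacing each occurrence of the $i$th smallest letter with $i$. For a word (pattern) $p=p_1\cdots p_k$ with $\mathrm{red}(p)=p$, a word $w=w_1\cdots w_\ell$ contains $p$ if there are indices $i_1<\cdots<i_k$ with $\mathrm{red}(w_{i_1}\cdots w_{i_k})=p$; otherwise $w$ avoids $p$ (is $p$-avoiding). A labeled graph with vertex set $[n]$ is $12$-represented by a word $w$ over $[n]$ containing at least one copy of each letter of $[n]$ if for all $i<j$ in $[n]$: $i$ and $j$ are adjacent if and only if every occurrence of $j$ precedes every occurrence of $i$ in $w$. An (unlabeled) graph on $n$ vertices is $12$-representable by a $p$-avoiding word if its vertices can be labeled bijectively by $[n]$ so that the resulting labeled graph is $12$-represented by some $p$-avoiding word. A graph is trivially perfect if it is the intersection graph of a family of intervals on the real line (one interval per vertex, two distinct vertices adjacent if and only if their intervals intersect) in which any two intervals are either disjoint or one contains the other. *)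

(* Defs.v *)
From mathcomp Require Import all_boot all_order all_algebra.
From mathcomp Require Import classical_sets reals.

Set Implicit Arguments.
Unset Strict Implicit.
Unset Printing Implicit Defensive.

Definition simple_graph (T : finType) (e : rel T) : Prop :=
  symmetric e /\ irreflexive e.

(* The rank of a letter is counted among the distinct letters of w, from 1. *)
Definition red (w : seq nat) : seq nat :=
  [seq count (fun y => y <= x) (undup w) | x <- w].

Definition contains_pattern (p w : seq nat) : Prop :=
  exists s : seq nat, subseq s w /\ red s = p.

Definition avoids_pattern (p w : seq nat) : Prop := ~ contains_pattern p w.

(* [n] is encoded as 'I_n: the label k of {1, ..., n} is the ordinal k - 1.
   This shift preserves the order of the labels, hence red and the patterns
   contained in a word. *)
Definition represents12 (n : nat) (E : rel 'I_n) (w : seq 'I_n) : Prop :=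
  (forall i : 'I_n, i \in w) /\
  forall i j : 'I_n, i < j ->
    (E i j <->
     forall a b : nat, onth w a = Some j -> onth w b = Some i -> a < b).

(* v i is the vertex that receives the label i. *)
Definition representable12_avoiding
    (p : seq nat) (T : finType) (e : rel T) : Prop :=
  exists (v : 'I_#|T| -> T) (w : seq 'I_#|T|),
    [/\ bijective v,
        represents12 (fun i j => e (v i) (v j)) w
      & avoids_pattern p (map val w)].

Local Open Scope classical_set_scope.

(* The type interval R has open, closed, half-open and unbounded intervals,
   and also empty ones such as `[1, 0], which are excluded here. *)
Definition trivially_perfect (R : realType) (T : finType) (e : rel T) : Prop :=
  exists I : T -> interval R,
    [/\ forall x, [set` I x] !=set0,
        forall x y, x != y -> (e x y <-> [set` I x] `&` [set` I y] !=set0)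
      & forall x y, [\/ [set` I x] `&` [set` I y] = set0,
                        [set` I x] `<=` [set` I y]
                      | [set` I y] `<=` [set` I x]]].

(* Main.v *)
Require Import Defs.
From mathcomp Require Import all_boot all_order all_algebra.
From mathcomp Require Import boolp classical_sets reals num_normedtype.
From mathcomp Require Import zify.

(** Both sides are equivalent to the existence of a labelling of the vertices
    like the postorder numbering of a rooted forest whose comparability graph
    is [e]: a vertex is adjacent to exactly its ancestors and descendants, each
    vertex comes after its descendants, and the descendants of [k] are the
    labels immediately below [k].  On the labels alone
    ([postorder_labelled]) this says that, for [i < j < k], adjacency is
    transitive along [i], [j], [k], and that [i] adjacent to [k] forces [j]
    adjacent to [k].

    In a word that represents the graph, adjacency of [i < j] means that all
    [j] precede all [i], so transitivity is automatic.  If [i] and [k] are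
    adjacent but [j] and [k] are not, some [j] comes before some [k], and that
    [k] before every [i]: these letters form 231 ([postorder_of_word]).
    Conversely, the two conditions say that the adjacent pairs are the
    inversions of a permutation; it is the preorder traversal of the forest,
    and its one-line word avoids 231 ([word_of_postorder]).

    From a postorder labelling, the intervals [[low k, k]], where [low k] is
    the least descendant of [k], form a model of pairwise nested or disjoint
    intervals ([trivially_perfect_of_postorder]).  Conversely, ordering the
    intervals of such a model by inclusion, and disjoint ones from left to
    right, gives a total preorder, and any enumeration of the vertices along
    it is a postorder labelling ([postorder_of_trivially_perfect]). *)

Set Implicit Arguments.
Unset Strict Implicit.
Unset Printing Implicit Defensive.

Import Order.TTheory GRing.Theory Num.Theory.

(** * Postorder labellings *)

(** Read [E i k] with [i < k] as saying that [i] is a descendant of [k].  By the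
    first clause this is a strict order; by the second, the descendants of [k]
    are consecutive just below [k]. *)
Definition postorder_labelled (n : nat) (E : rel 'I_n) : Prop :=
  forall i j k : 'I_n, i < j -> j < k ->
    (E i j -> E j k -> E i k) /\ (E i k -> E j k).

(** * From words to postorder labellings *)

(** Standardization is monotone: a larger letter has at least the rank of a
    smaller one.  Hence distinct ranks in [red s] reveal the order of the
    letters of [s]. *)
Lemma contains_231P (w : seq nat) :
  contains_pattern [:: 2; 3; 1] w <->
  exists x y z, [/\ subseq [:: x; y; z] w, z < x & x < y].
Proof.
split=> [[s [sw]]|[x [y [z [sw zx xy]]]]]; last first.
  exists [:: x; y; z]; split=> //.
  rewrite /red /= !inE.
  have -> : (x == y) = false by lia.
  have -> : (x == z) = false by lia.
  have -> : (y == z) = false by lia.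
  rewrite /= !leqnn.
  have -> : (y <= x) = false by lia.
  have -> : (z <= x) by lia.
  have -> : (x <= y) by lia.
  have -> : (z <= y) by lia.
  have -> : (x <= z) = false by lia.
  by have -> : (y <= z) = false by lia.
case: s sw => [//|x [//|y [//|z [|//]]]] sw.
rewrite /red /=; set u := (X in count _ X); move=> [rx ry rz].
have rank_lt a b : count (leq^~ a) u < count (leq^~ b) u -> a < b.
  apply: contraTT; rewrite -!leqNgt => ba.
  by apply: sub_count => c /= cb; apply: leq_trans ba.
exists x, y, z; split=> //; apply: rank_lt.
  by rewrite rx rz.
by rewrite rx ry.
Qed.

(** The case of one letter, [cons_onth], is iterated: each later letter is
    looked up in the part of [w] that follows the previous one. *)
Lemma subseq_onth3 (T : eqType) (w : seq T) a b c x y z :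
  onth w a = Some x -> onth w b = Some y -> onth w c = Some z ->
  a < b -> b < c -> subseq [:: x; y; z] w.
Proof.
have cons_onth (s u : seq T) t d :
    onth u d = Some t -> subseq s (drop d.+1 u) -> subseq (t :: s) u.
  elim: u d => [|h u IHu] [|d] //=.
    by move=> [->]; rewrite eqxx drop0.
  move=> ud sd; have tsu := IHu _ ud sd.
  by case: ifP => // _; apply: subseq_trans tsu; apply: subseq_cons.
have onth_shift (u : seq T) d d' : d < d' ->
    onth (drop d.+1 u) (d' - d.+1) = onth u d'.
  by move=> dd'; rewrite !onthE map_drop nth_drop; congr nth; lia.
move=> wa wb wc ab bc; apply: (cons_onth _ _ _ a) => //.
apply: (cons_onth _ _ _ (b - a.+1)); first by rewrite onth_shift.
rewrite drop_drop; have -> : (b - a.+1).+1 + a.+1 = b.+1 by lia.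
apply: (cons_onth _ _ _ (c - b.+1)); first by rewrite onth_shift.
exact: sub0seq.
Qed.

(** Transitivity of precedence needs an occurrence of the middle letter, which
    is why every letter must occur in [w].  The second clause is where the
    pattern is used: a [j] before a [k] would be followed by an [i], all of
    whose occurrences come after every [k]. *)
Lemma postorder_of_word (n : nat) (E : rel 'I_n) (w : seq 'I_n) :
  represents12 E w -> avoids_pattern [:: 2; 3; 1] (map val w) ->
  postorder_labelled E.
Proof.
move=> [win wE] av i j k ij jk; have ik := ltn_trans ij jk; split.
  move=> /(wE _ _ ij) ji /(wE _ _ jk) kj; apply/(wE _ _ ik) => a c wa wc.
  have /onthP[b wb] := win j.
  exact: ltn_trans (kj _ _ wa wb) (ji _ _ wb wc).
move=> /(wE _ _ ik) ki; apply/(wE _ _ jk) => b a wb wa.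
rewrite ltnNge; apply/negP => ab; apply: av; apply/contains_231P.
have {}ab : a < b.
  rewrite ltn_neqAle ab andbT; apply: contraTneq jk => ab'.
  by move: wa; rewrite ab' wb => -[->]; rewrite ltnn.
have /onthP[c wc] := win i.
exists (val j), (val k), (val i); split=> //.
apply: (map_subseq val (s1 := [:: j; k; i])).
exact: subseq_onth3 wa wb wc ab (ki _ _ wb wc).
Qed.

(** * From postorder labellings to words *)

(** The order in which a traversal that visits ancestors first, and unrelated
    vertices by increasing label, meets the vertices: its inversions with
    respect to the labels are exactly the adjacent pairs. *)
Definition preorder_le (n : nat) (E : rel 'I_n) : rel 'I_n :=
  fun i j => if i < j then ~~ E i j else (i == j) || E j i.

Lemma preorder_le_total n (E : rel 'I_n) : total (preorder_le E).
Proof.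
move=> i j; rewrite /preorder_le (eq_sym j i).
have [//|//|/val_inj ->] := ltngtP i j; last by rewrite eqxx.
- by rewrite orbC; case: (E i j); rewrite ?orbT.
- by case: (E j i); rewrite ?orbT.
Qed.

Lemma preorder_le_anti n (E : rel 'I_n) : antisymmetric (preorder_le E).
Proof.
move=> i j; rewrite /preorder_le (eq_sym j i).
have [ij|ij|/val_inj //] := ltngtP i j.
- by case: eqP => //= _ /andP[/negP].
- by case: eqP => //= _ /andP[? /negP].
Qed.

(** A set of pairs is the inversion set of a permutation when it and its
    complement are both transitive.  The first clause of
    [postorder_labelled] gives the former, and the second more than the
    latter, namely that [E i k] implies [E j k].  The cases below are the
    relative orders of the three labels. *)
Lemma preorder_le_trans n (E : rel 'I_n) :
  postorder_labelled E -> transitive (preorder_le E).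
Proof.
move=> pE j i k; rewrite /preorder_le.
have [ij|ji|/val_inj -> //] := ltngtP i j;
  have [jk|kj|/val_inj <-] := ltngtP j k.
- move=> nEij nEjk; rewrite (ltn_trans ij jk).
  by apply: contra nEjk; apply: (proj2 (pE _ _ _ ij jk)).
- rewrite -!val_eqE (gtn_eqF kj) /= => nEij Ekj.
  have [ik|ki|/val_inj ik] //= := ltngtP i k.
  + by apply: contra nEij => Eik; apply: (proj1 (pE _ _ _ ik kj)).
  + by case/negP: nEij; apply: (proj2 (pE _ _ _ ki ij)).
- by rewrite ij.
- rewrite -!val_eqE (gtn_eqF ji) /= => Eji nEjk.
  have [ik|ki|/val_inj ik] //= := ltngtP i k.
  + by apply: contra nEjk; apply: (proj1 (pE _ _ _ ji ik)).
  + exact: (proj2 (pE _ _ _ jk ki)).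
- have ki := ltn_trans kj ji.
  rewrite -!val_eqE (gtn_eqF ji) (gtn_eqF kj) (ltnNge i k) (ltnW ki) /=.
  by rewrite (gtn_eqF ki) => Eji Ekj; apply: (proj1 (pE _ _ _ kj ji)).
- by rewrite (ltnNge i j) (ltnW ji).
Qed.

(** The word lists each label once, in preorder.  A 231 formed by [j], [k], [i]
    with [i < j < k] would make [i] and [k] an inversion, hence adjacent,
    but not [j] and [k], against the second clause. *)
Lemma word_of_postorder n (E : rel 'I_n) :
  postorder_labelled E ->
  exists w, represents12 E w /\ avoids_pattern [:: 2; 3; 1] (map val w).
Proof.
move=> pE; pose w := sort (preorder_le E) (enum 'I_n).
have tr := preorder_le_trans pE.
have w_sorted : sorted (preorder_le E) w by apply/sort_sorted/preorder_le_total.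
have w_le a b i j : onth w a = Some i -> onth w b = Some j -> a <= b ->
    preorder_le E i j.
  move=> wa wb ab.
  have refl : reflexive (preorder_le E).
    by move=> x; rewrite /preorder_le ltnn eqxx.
  have aw : a < size w by rewrite -onthTE wa.
  have bw : b < size w by rewrite -onthTE wb.
  have := sorted_leq_nth tr refl i w_sorted a b aw bw ab.
  by move: wa wb; rewrite !onthE !(nth_map i) // => -[->] [->].
exists w; split.
  split=> [i|i j ij]; first by rewrite mem_sort mem_enum.
  have neq_ij : j != i by rewrite -val_eqE gtn_eqF.
  have ji : preorder_le E j i = E i j.
    by rewrite /preorder_le ltnNge (ltnW ij) (negbTE neq_ij).
  split=> [Eij a b wa wb|all_lt].
    rewrite ltnNge; apply: contra neq_ij => ba; apply/eqP.
    by apply: (preorder_le_anti (E := E)); rewrite ji Eij (w_le _ _ _ _ wb wa).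
  have mem_w x : x \in w by rewrite mem_sort mem_enum.
  have /onthP[a wa] := mem_w j; have /onthP[b wb] := mem_w i.
  by rewrite -ji; apply: (w_le a b) => //; apply: ltnW (all_lt _ _ wa wb).
move=> /contains_231P [x [y [z [/subseqP[m _]]]]].
rewrite -map_mask; case mw : (mask m w) => [|j [|k [|i [|//]]]] //= [-> -> ->].
move=> ij jk; have ik := ltn_trans ij jk.
have : sorted (preorder_le E) [:: j; k; i].
  by rewrite -mw; apply: subseq_sorted (mask_subseq _ _) w_sorted.
rewrite /= /preorder_le jk (ltnNge k i) (ltnW ik) /= andbT.
case/andP=> nEjk; rewrite -val_eqE gtn_eqF //= => Eik.
by case/negP: nEjk; apply: (proj2 (pE _ _ _ ij jk)).
Qed.

(** * From postorder labellings to intervals *)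

Local Open Scope classical_set_scope.

(** The interval of a label [k] spans [k] and its descendants, which are
    consecutive.  For [i < k] it meets that of [i] exactly when it contains
    the right end [i], that is when [i] is a descendant of [k], and then by
    transitivity it contains all descendants of [i] too. *)
Lemma trivially_perfect_of_postorder (R : realType) (T : finType) (e : rel T)
    (v : 'I_#|T| -> T) :
  symmetric e -> bijective v ->
  postorder_labelled (fun i j => e (v i) (v j)) -> trivially_perfect R e.
Proof.
move=> esym [g vK gK]; set E := fun i j => _; move=> pE.
pose low (k : 'I_#|T|) : 'I_#|T| := [arg min_(j < k | (j == k) || E j k) val j].
have lowP k : ((low k == k) || E (low k) k) /\
    forall j, (j == k) || E j k -> low k <= j.
  have kk : (k == k) || E k k by rewrite eqxx.
  by rewrite /low; case: arg_minnP.
have low_le k : low k <= k by apply: (proj2 (lowP k)); rewrite eqxx.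
have low_adj k : low k < k -> E (low k) k.
  by case: (lowP k) => /predU1P[->|//]; rewrite ltnn.
have low_min j k : E j k -> low k <= j.
  by move=> Ejk; apply: (proj2 (lowP k)); rewrite Ejk orbT.
have adjE (i k : 'I_#|T|) : i < k -> E i k = (low k <= i).
  move=> ik; apply/idP/idP => [/low_min //|].
  rewrite leq_eqVlt => /predU1P[/val_inj li|li].
    by rewrite -li; apply: low_adj; rewrite li.
  exact: (proj2 (pE _ _ _ li ik)) (low_adj _ (ltn_trans li ik)).
have low_mono (i k : 'I_#|T|) : i < k -> low k <= i -> low k <= low i.
  move=> ik; rewrite -adjE // => Eik.
  have := low_le i; rewrite leq_eqVlt => /predU1P[/val_inj ->|li].
    exact: low_min.
  by apply: low_min; apply: (proj1 (pE _ _ _ li ik)) => //; apply: low_adj.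
pose I k : interval R := `[(low k)%:R, (val k)%:R]%R.
have inI k (t : R) : [set` I k] t = ((low k)%:R <= t <= (val k)%:R)%R :> Prop.
  by rewrite /= in_itv.
have meetE (i k : 'I_#|T|) :
    i < k -> [set` I i] `&` [set` I k] !=set0 <-> low k <= i.
  move=> ik; split=> [[t []]|li]; rewrite ?inI.
    by move=> /andP[_ ti] /andP[kt _]; rewrite -(ler_nat R); apply: le_trans ti.
  exists (val i)%:R%R; split; rewrite inI !ler_nat ?low_le ?leqnn //.
  by rewrite li ltnW.
have subI (i k : 'I_#|T|) : i < k -> low k <= i -> [set` I i] `<=` [set` I k].
  move=> ik li t; rewrite !inI => /andP[it ti]; apply/andP; split.
    by apply: le_trans it; rewrite ler_nat low_mono.
  by apply: le_trans ti _; rewrite ler_nat ltnW.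
(* All statements about pairs below are symmetric, so it is enough to treat
   pairs of labels in increasing order. *)
have pair_wlog (P : 'I_#|T| -> 'I_#|T| -> Prop) :
    (forall i j, P i j -> P j i) -> (forall i, P i i) ->
    (forall i j : 'I_#|T|, i < j -> P i j) -> forall i j, P i j.
  move=> Psym Prefl Plt i j.
  by have [/Plt//|/Plt/Psym//|/val_inj ->//] := ltngtP i j.
exists (I \o g); split=> /=.
- by move=> x; exists (val (g x))%:R%R; rewrite inI !ler_nat low_le leqnn.
- move=> x y; rewrite -{1 2}(gK x) -{1 2}(gK y) (inj_eq (can_inj vK)).
  move: (g x) (g y); apply: pair_wlog => [i j IH|i|i j ij _].
  + by rewrite eq_sym esym setIC.
  + by rewrite eqxx.
  + by rewrite meetE // -adjE.
- move=> x y; move: (g x) (g y); apply: pair_wlog => [i j|i|i j ij].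
  + by rewrite setIC => -[]; [constructor 1|constructor 3|constructor 2].
  + by constructor 2.
  + case: (leqP (low j) i) => li; first by constructor 2; apply: subI.
    constructor 1; apply/eqP/negPn/negP => /set0P/(meetE _ _ ij).
    by rewrite leqNgt li.
Qed.

(** * From intervals to postorder labellings *)

Definition left_of (R : realType) (A B : set R) : Prop :=
  forall a b, A a -> B b -> (a < b)%R.

(** Convexity is what decides the side: if [c < d] but [d' <= c'] for [c], [c']
    in one interval and [d], [d'] in the other, then [d'] lies between [c] and
    [c'], or [c] lies between [d'] and [d], so the intervals meet. *)
Lemma left_of_disjoint (R : realType) (A B : interval R) :
  [set` A] !=set0 -> [set` B] !=set0 -> [set` A] `&` [set` B] = set0 ->
  left_of [set` A] [set` B] \/ left_of [set` B] [set` A].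
Proof.
have main (C D : interval R) c d : [set` C] c -> [set` D] d ->
    [set` C] `&` [set` D] = set0 -> (c < d)%R -> left_of [set` C] [set` D].
  move=> Cc Dd CD0 cd c' d' Cc' Dd'; rewrite ltNge; apply/negP => d'c'.
  have no_common t : [set` C] t -> [set` D] t -> False.
    by move=> Ct Dt; suff: (set0 : set R) t by []; rewrite -CD0.
  have [cd'|d'c] := leP c d'.
    by apply: (no_common d') => //; apply: (interval_is_interval Cc Cc');
      rewrite cd'.
  by apply: (no_common c) => //; apply: (interval_is_interval Dd' Dd);
    rewrite !ltW.
move=> [a Aa] [b Bb] AB0; have [ab|ba|ab] := ltgtP a b.
- by left; apply: main Aa Bb AB0 ab.
- by right; apply: main Bb Aa _ ba; rewrite setIC.
- by suff: (set0 : set R) a by []; rewrite -AB0; split=> //=; rewrite ab.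
Qed.

(** Inclusion or being to the left is a total preorder [le] on the vertices.
    Vertices with equal intervals are tied, and can be enumerated in any order:
    for vertices that come in this order, adjacency is inclusion of the
    earlier interval in the later one ([v_adj]), and the two clauses only use
    inclusions and [le]. *)
Lemma postorder_of_trivially_perfect (R : realType) (T : finType) (e : rel T) :
  trivially_perfect R e ->
  exists v : 'I_#|T| -> T,
    bijective v /\ postorder_labelled (fun i j => e (v i) (v j)).
Proof.
move=> [I [I0 eI lam]]; pose S x := [set` I x].
pose le x y := `[< left_of (S x) (S y) \/ S x `<=` S y >].
have leP x y : reflect (left_of (S x) (S y) \/ S x `<=` S y) (le x y).
  exact: asboolP.
have left_meet x y t : left_of (S x) (S y) -> S x t -> S y t -> False.
  by move=> xy xt yt; have := xy t t xt yt; rewrite ltxx.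
have le_total : total le.
  move=> x y; apply/orP.
  have [xy0|xy|yx] := lam x y.
  - have [xy|yx] := left_of_disjoint (I0 x) (I0 y) xy0.
    + by left; apply/leP; left.
    + by right; apply/leP; left.
  - by left; apply/leP; right.
  - by right; apply/leP; right.
have le_trans : transitive le.
  move=> y x z /leP[xy|xy] /leP[yz|yz]; apply/leP.
  - left=> a c xa zc; have [b yb] := I0 y.
    exact: lt_trans (xy _ _ xa yb) (yz _ _ yb zc).
  - have [b yb] := I0 y; have [a xa] := I0 x.
    have [xz0|xz|zx] := lam x z.
    + have [//|zx] := left_of_disjoint (I0 x) (I0 z) xz0; first by left.
      by have := lt_trans (xy _ _ xa yb) (zx _ _ (yz _ yb) xa); rewrite ltxx.
    + by right.
    + by case: (left_meet _ _ b xy) => //; apply/zx/yz.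
  - by left=> a c /xy; apply: yz.
  - by right; apply: subset_trans yz.
(* For [le]-comparable vertices, the alternatives of [le] are exclusive: the
   intervals meet in the case of inclusion only. *)
have le_meet x y : le x y -> S x `&` S y !=set0 -> S x `<=` S y.
  by move=> /leP[xy [t [xt yt]]|//]; case: (left_meet _ _ _ xy xt yt).
have sub_meet x y : S x `<=` S y -> S x `&` S y !=set0.
  by move=> xy; have [a xa] := I0 x; exists a; split=> //; apply: xy.
pose s := sort le (enum T); have size_s : size s = #|T|.
  by rewrite size_sort -cardE.
(* The default value is never reached; [vE] makes it the same for all [i]. *)
pose v (i : 'I_#|T|) := nth (enum_val i) s i.
have vE i x0 : v i = nth x0 s i by apply: set_nth_default; rewrite size_s.
have v_inj : injective v.
  move=> i j; rewrite (vE i (enum_val i)) (vE j (enum_val i)) => /eqP.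
  by rewrite nth_uniq ?size_s ?sort_uniq ?enum_uniq // => /eqP/val_inj.
have v_le (i j : 'I_#|T|) : i < j -> le (v i) (v j).
  move=> ij; rewrite (vE i (enum_val i)) (vE j (enum_val i)).
  apply: (sorted_ltn_nth le_trans); rewrite ?inE ?size_s //.
  exact: sort_sorted.
exists v; split; first by apply: inj_card_bij; rewrite ?card_ord.
have v_neq (i j : 'I_#|T|) : i < j -> v i != v j.
  by move=> ij; rewrite (inj_eq v_inj) -val_eqE ltn_eqF.
have v_adj (i j : 'I_#|T|) : i < j -> e (v i) (v j) <-> S (v i) `<=` S (v j).
  move=> ij; rewrite (eI _ _ (v_neq _ _ ij)).
  by split=> [/le_meet|/sub_meet]; first by apply; apply: v_le.
move=> i j k ij jk; have ik := ltn_trans ij jk.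
rewrite !v_adj //; split=> [|ik_sub]; first exact: subset_trans.
(* If [j] were entirely to the left of [k], while [i] lies inside [k], then [i]
   could be neither to the left of [j] nor inside [j]. *)
case/leP: (v_le _ _ jk) => // jk_left; case/leP: (v_le _ _ ij) => ij_sub.
  have [b jb] := I0 (v j); have [a ia] := I0 (v i).
  have := lt_trans (ij_sub _ _ ia jb) (jk_left _ _ jb (ik_sub _ ia)).
  by rewrite ltxx.
have [a ia] := I0 (v i).
by case: (left_meet _ _ a jk_left); [apply: ij_sub|apply: ik_sub].
Qed.

Theorem theorem20 (R : realType) (T : finType) (e : rel T)
    (he : simple_graph e) :
  representable12_avoiding [:: 2; 3; 1] e <-> trivially_perfect R e.
Proof.
split=> [[v [w [v_bij rep av]]]|/postorder_of_trivially_perfect[v [v_bij pE]]].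
  apply: trivially_perfect_of_postorder v_bij _; first exact: (proj1 he).
  exact: postorder_of_word rep av.
by have [w [rep av]] := word_of_postorder pE; exists v, w.
Qed.
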